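(* Let $\alpha_0,\alpha_1,\alpha_2,\beta_1,\beta_2,\gamma_0,\gamma_1,\gamma_2,\delta_1,\delta_2\in\mathbb{C}$ be parameters such that the rational function $$H(x,y)=\frac{\alpha_0+\alpha_1x+\alpha_2y+\frac{\beta_1}{x}+\frac{\beta_2}{y}}{\gamma_0+\gamma_1x+\gamma_2y+\frac{\delta_1}{x}+\frac{\delta_2}{y}}$$ is well defined, has degree exactly $2$ as a rational function of $x$ over $\mathbb{C}(y)$, and has degree exactly $2$ as a rational function of $y$ over $\mathbb{C}(x)$. Then the QRT map associated to the integral $H$ is $$\phi:(x,y)\mapsto(X,Y)=\left(\frac1x\,\frac{\beta_1-\delta_1H(x,y)}{\alpha_1-\gamma_1H(x,y)},\ \frac1y\,\frac{\beta_2-\delta_2H(x,y)}{\alpha_2-\gamma_2H(x,y)}\right).$$ It is an involution, i.e. $\phi\circ\phi=\mathrm{id}$ as rational maps, and moreover it is a quadrirational map in the narrow sense, i.e. the map, its companion map and their inverses all have the same functional form.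
   Context: All maps are rational maps of $\mathbb{CP}^1\times\mathbb{CP}^1$ over $\mathbb{C}$; equalities of maps are equalities of rational maps (i.e. hold at generic points). QRT map. Let $H(x,y)$ be a ratio of two biquadratic polynomials (degree at most $2$ in each of $x$, $y$), of degree exactly $2$ in each variable. The equation $H(X,y)=H(x,y)$ has two solutions for $X$: $X=x$ and a second one; $\sigma^1:(x,y)\mapsto(X,y)$ is the involution given by the second solution. Similarly $\sigma^2:(x,y)\mapsto(x,Y)$ is given by the solution of $H(x,Y)=H(x,y)$ for $Y$ other than $Y=y$. The QRT map associated to the integral $H$ is $\phi=\sigma^2\circ\sigma^1$; thus, with $\phi(x,y)=(X,Y)$, one has $H(x,y)=H(X,y)=H(X,Y)$. Quadrirationality. A rational map $R:\mathbb{CP}^1\times\mathbb{CP}^1\to\mathbb{CP}^1\times\mathbb{CP}^1$, $(x,y)\mapsto(X,Y)$, is called quadrirational if the maps $R^{-1}:(X,Y)\mapsto(x,y)$, $R^c:(X,y)\mapsto(x,Y)$ and $(R^c)^{-1}:(x,Y)\mapsto(X,y)$, obtained by solving the relation $(X,Y)=R(x,y)$ for the indicated variables, are (well defined and) rational maps as well; $R^c$ is called the companion map of $R$. It is quadrirational in the narrow sense if moreover $R$, $R^{-1}$, $R^c$, $(R^c)^{-1}$ all have the same functional form, i.e. are given by the same formulas with $(x,y)$ replaced by the respective pair of input variables (so that, as rational self-maps of $\mathbb{CP}^1\times\mathbb{CP}^1$, they coincide). *)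

(* Defs.v *)
(* The complex numbers are taken as [R[i]] for a [realType] [R].

   Rational maps of P^1 x P^1 are represented by their value at the generic
   point: a rational map P^1 x P^1 --> P^1 over a field [k] is the same thing
   as a point of P^1(k(x, y)), so that equality of rational maps (agreement at
   generic points) is equality in P^1(k(x, y)) = k(x, y) + {oo}. *)
From HB Require Import structures.
From mathcomp Require Import all_boot all_order all_algebra.
From mathcomp Require Export complex.
From mathcomp Require Export reals.

Set Implicit Arguments.
Unset Strict Implicit.
Unset Printing Implicit Defensive.

Import GRing.Theory.
Local Open Scope ring_scope.

Definition ratfun (F : fieldType) : fieldType := {fraction {poly F}}.

Definition rf_const (F : fieldType) (c : F) : ratfun F := FracField.tofrac c%:P.

Definition rf_var (F : fieldType) : ratfun F := FracField.tofrac ('X : {poly F}).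

(* Degree of a rational function of one variable over the field [F]. *)
Definition has_degree (F : fieldType) (h : ratfun F) (d : nat) : Prop :=
  exists p q : {poly F},
    [/\ q != 0, coprimep p q,
        h = FracField.tofrac p / FracField.tofrac q
      & maxn (size p) (size q) = d.+1].

(* [ratfun2 k] is k(s)(t), where s and t are [inner_var k] and [outer_var k].
   For rational maps, x is the outer and y the inner variable.  For a formula
   h(x, y), [has_degree (h outer inner)] is about the degree in x over k(y) and
   [has_degree (h inner outer)] about the degree in y over k(x). *)
Definition ratfun2 (k : fieldType) : fieldType := ratfun (ratfun k).

Definition rf2_const (k : fieldType) (c : k) : ratfun2 k :=
  rf_const (rf_const c).

Definition outer_var (k : fieldType) : ratfun2 k := rf_var (ratfun k).

Definition inner_var (k : fieldType) : ratfun2 k := rf_const (rf_var k).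

(* P^1(L), with [None] the point at infinity. *)
Definition P1 (L : fieldType) := option L.

Definition hcoord (L : fieldType) (u : P1 L) : L * L :=
  if u is Some a then (a, 1) else (1, 0).

(* The point [a : b]; only meaningful for (a, b) <> (0, 0). *)
Definition P1_of_ratio (L : fieldType) (a b : L) : P1 L :=
  if b == 0 then None else Some (a / b).

Definition P1x (k : fieldType) : P1 (ratfun2 k) := Some (outer_var k).
Definition P1y (k : fieldType) : P1 (ratfun2 k) := Some (inner_var k).

(* The bihomogeneous form of bidegree (m, n) with coefficients M. *)
Definition biform (k : fieldType) (m n : nat) (M : 'M[k]_(m.+1, n.+1))
    (u v : P1 (ratfun2 k)) : ratfun2 k :=
  \sum_(i < m.+1) \sum_(j < n.+1)
     rf2_const (M i j) * (hcoord u).1 ^+ i * (hcoord u).2 ^+ (m - i)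
                       * (hcoord v).1 ^+ j * (hcoord v).2 ^+ (n - j).

(* [rat_value h u v w]: the rational function h is regular at the
   k(x, y)-point (u, v) of P^1 x P^1 and takes the value w there, i.e. h can be
   written [P : Q] with P and Q bihomogeneous of the same bidegree, not both
   vanishing at (u, v), and [P(u, v) : Q(u, v)] = w. *)
Definition rat_value (k : fieldType) (h u v w : P1 (ratfun2 k)) : Prop :=
  exists (m n : nat) (P Q : 'M[k]_(m.+1, n.+1)),
    [/\ (P != 0) || (Q != 0),
        h = P1_of_ratio (biform P (P1x k) (P1y k)) (biform Q (P1x k) (P1y k)),
        (biform P u v != 0) || (biform Q u v != 0)
      & w = P1_of_ratio (biform P u v) (biform Q u v)].

(* Rational self-maps of P^1 x P^1; also the k(x, y)-points of P^1 x P^1. *)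
Definition ratmap (k : fieldType) : Type :=
  (P1 (ratfun2 k) * P1 (ratfun2 k))%type.

Definition rm_id (k : fieldType) : ratmap k := (P1x k, P1y k).

Definition maps_to (k : fieldType) (f p q : ratmap k) : Prop :=
  rat_value f.1 p.1 p.2 q.1 /\ rat_value f.2 p.1 p.2 q.2.

(* h = f o g.  Substituting g in f means evaluating f at the point g, which is
   the image of the generic point by g. *)
Definition is_comp (k : fieldType) (f g h : ratmap k) : Prop := maps_to f g h.

(* H is [P : Q] with P and Q of degree at most 2 in each variable. *)
Definition biquadratic_ratio (k : fieldType) (H : P1 (ratfun2 k)) : Prop :=
  exists P Q : 'M[k]_(3, 3), ((P != 0) || (Q != 0)) /\
    H = P1_of_ratio (biform P (P1x k) (P1y k)) (biform Q (P1x k) (P1y k)).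

(* The solutions X of H(X, y) = H(x, y) are exactly x and s.1.  In
   characteristic 0 a root of multiplicity two cannot occur generically, so the
   second solution is distinct from x. *)
Definition is_sigma1 (k : fieldType) (H : P1 (ratfun2 k)) (s : ratmap k) :=
  [/\ s.1 <> P1x k,
      forall X, rat_value H X (P1y k) H <-> X = P1x k \/ X = s.1
    & s.2 = P1y k].

Definition is_sigma2 (k : fieldType) (H : P1 (ratfun2 k)) (s : ratmap k) :=
  [/\ s.2 <> P1y k,
      forall Y, rat_value H (P1x k) Y H <-> Y = P1y k \/ Y = s.2
    & s.1 = P1x k].

Definition is_qrt_map (k : fieldType) (H : P1 (ratfun2 k)) (f : ratmap k) :=
  biquadratic_ratio H /\
  exists s1 s2, [/\ is_sigma1 H s1, is_sigma2 H s2 & is_comp s2 s1 f].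

(* The next three definitions say that a rational map S solves the relation
   (X, Y) = R(x, y) for the indicated variables: S recovers the unknowns along
   the graph of R at generic (x, y), and conversely the output of S at a generic
   point satisfies the relation. *)

(* S : (X, Y) |-> (x, y) *)
Definition is_inverse (k : fieldType) (R S : ratmap k) : Prop :=
  maps_to S (R.1, R.2) (P1x k, P1y k) /\
  maps_to R (S.1, S.2) (P1x k, P1y k).

(* S : (X, y) |-> (x, Y) *)
Definition is_companion (k : fieldType) (R S : ratmap k) : Prop :=
  maps_to S (R.1, P1y k) (P1x k, R.2) /\
  maps_to R (S.1, P1y k) (P1x k, S.2).

(* S : (x, Y) |-> (X, y) *)
Definition is_companion_inverse (k : fieldType) (R S : ratmap k) : Prop :=
  maps_to S (P1x k, R.2) (R.1, P1y k) /\
  maps_to R (P1x k, S.2) (S.1, P1y k).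

Definition quadrirational_narrow (k : fieldType) (R : ratmap k) : Prop :=
  exists Rinv Rc Rcinv : ratmap k,
    [/\ is_inverse R Rinv, is_companion R Rc & is_companion_inverse R Rcinv]
    /\ [/\ Rinv = R, Rc = R & Rcinv = R].

Definition laurent5 (k : fieldType) (c0 c1 c2 e1 e2 : k) (x y : ratfun2 k) :
    ratfun2 k :=
  rf2_const c0 + rf2_const c1 * x + rf2_const c2 * y
  + rf2_const e1 / x + rf2_const e2 / y.

(* Main.v *)
(* Clearing denominators, the level set H = h is the curve of the pencil
   A0 x y + A1 x^2 y + A2 x y^2 + B1 y + B2 x = 0, that is
   A0 + (A1 x + B1/x) + (A2 y + B2/y) = 0, where A_i = alpha_i - gamma_i h and
   B_i = beta_i - delta_i h.  Hence x and X = B1/(A1 x) are the two points with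
   the same y, and y and Y = B2/(A2 y) the two points with the same x.  Since
   the switches x <-> X and y <-> Y are independent of each other, the four
   points (x, y), (X, y), (x, Y), (X, Y) lie on one level curve, so that h, and
   with it the formula of phi, is the same at all four; involutivity and
   quadrirationality follow.  The degree hypotheses rule out the degenerate
   cases, and the values of H are determinate because the base points of the
   pencil have algebraic coordinates while y and Y are not constant. *)
Require Import Defs.
From HB Require Import structures.
From mathcomp Require Import all_boot all_order all_algebra complex reals ring.

Set Implicit Arguments.
Unset Strict Implicit.
Unset Printing Implicit Defensive.

Import GRing.Theory.
Local Open Scope ring_scope.
Local Open Scope complex_scope.

(** * Constants as ring morphisms, and homogeneous evaluation of polynomials *)

Fact rf_const_is_zmod_morphism (F : fieldType) : zmod_morphism (@rf_const F).
Proof. by move=> a b; rewrite /rf_const polyCB tofracB. Qed.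
Fact rf_const_is_monoid_morphism (F : fieldType) : monoid_morphism (@rf_const F).
Proof. by split=> [|a b]; rewrite /rf_const ?polyC1 ?tofrac1 // polyCM tofracM. Qed.
HB.instance Definition _ (F : fieldType) :=
  GRing.isZmodMorphism.Build F (ratfun F) (@rf_const F) (@rf_const_is_zmod_morphism F).
HB.instance Definition _ (F : fieldType) :=
  GRing.isMonoidMorphism.Build F (ratfun F) (@rf_const F) (@rf_const_is_monoid_morphism F).

HB.instance Definition _ (k : fieldType) :=
  GRing.RMorphism.copy (@rf2_const k) (@rf_const (ratfun k) \o @rf_const k).

(** Value at [(a, b)] of the degree-[m] homogenisation of [p], so that [b = 0] covers the point at
    infinity. Coefficients of index above [m] are dropped, which is why products need size
    bounds. *)
Definition hom_eval (A : comNzRingType) (m : nat) (a b : A) (p : {poly A}) : A :=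
  \sum_(i < m.+1) p`_i * a ^+ i * b ^+ (m - i).

Lemma hom_eval_linear (A : comNzRingType) (m : nat) (a b : A) :
  linear_for *%R (hom_eval m a b).
Proof.
move=> c p q; rewrite /hom_eval mulr_sumr -big_split /=.
by apply: eq_bigr => i _; rewrite coefD coefZ !mulrDl !mulrA.
Qed.

HB.instance Definition _ (A : comNzRingType) (m : nat) (a b : A) :=
  GRing.isLinear.Build A {poly A} A *%R (hom_eval m a b) (hom_eval_linear m a b).

Lemma hom_evalXn (A : comNzRingType) (m i : nat) (a b : A) :
  (i <= m)%N -> hom_eval m a b 'X^i = a ^+ i * b ^+ (m - i).
Proof.
move=> le_im; have lt_im : (i < m.+1)%N by [].
rewrite /hom_eval (bigD1 (Ordinal lt_im)) //= coefXn eqxx mul1r big1 ?addr0 //.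
by move=> j; rewrite coefXn -val_eqE /= => /negPf ->; rewrite !mul0r.
Qed.

Lemma hom_eval1 (A : comNzRingType) (m : nat) (a : A) (p : {poly A}) :
  (size p <= m.+1)%N -> hom_eval m a 1 p = p.[a].
Proof.
move=> sp; rewrite (horner_coef_wide _ sp) /hom_eval.
by apply: eq_bigr => i _; rewrite expr1n mulr1.
Qed.

Lemma hom_evalM (A : comNzRingType) (m n : nat) (a b : A) (p q : {poly A}) :
  (size p <= m.+1)%N -> (size q <= n.+1)%N ->
  hom_eval (m + n) a b (p * q) = hom_eval m a b p * hom_eval n a b q.
Proof.
have def (r : {poly A}) l : (size r <= l.+1)%N -> r = \sum_(i < l.+1) r`_i *: 'X^i.
  move=> sr; rewrite -poly_def; apply/polyP => i; rewrite coef_poly.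
  by case: ltnP => // li; rewrite nth_default // (leq_trans sr).
move=> sp sq; rewrite {1}(def p m sp) {1}(def q n sq) mulr_suml linear_sum.
rewrite {2}/hom_eval mulr_suml; apply: eq_bigr => i _.
rewrite !mulr_sumr linear_sum; apply: eq_bigr => j _.
rewrite -scalerAl -scalerAr scalerA linearZ -exprD /=.
have [im jn] : (i <= m)%N /\ (j <= n)%N by split; rewrite -ltnS ltn_ord.
rewrite hom_evalXn ?leq_add // exprD.
rewrite (_ : m + n - (i + j) = (m - i) + (n - j))%N ?exprD; first by ring.
by rewrite subnDA addnC -addnBA // addnC addnBA.
Qed.

(** Presents a bihomogeneous form as two nested one-variable evaluations, so that multiplicativity
    carries over from [hom_evalM]. *)
Lemma hom_eval_poly2 (A : comNzRingType) (m n : nat) (f : nat -> nat -> A) (a b d e : A) :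
  hom_eval n d e
    (hom_eval m a%:P b%:P (\poly_(i < m.+1) \poly_(j < n.+1) f i j)) =
  \sum_(i < m.+1) \sum_(j < n.+1)
    f i j * a ^+ i * b ^+ (m - i) * d ^+ j * e ^+ (n - j).
Proof.
rewrite {2}/hom_eval linear_sum; apply: eq_bigr => i _.
rewrite coef_poly ltn_ord -!polyC_exp -mulrA -polyCM mulrC mul_polyC linearZ /=.
rewrite /hom_eval mulr_sumr; apply: eq_bigr => j _.
by rewrite coef_poly ltn_ord; ring.
Qed.

Lemma size_hom_eval_poly2 (A : comNzRingType) (m n : nat) (f : nat -> nat -> A) (a b : A) :
  (size (hom_eval m a%:P b%:P (\poly_(i < m.+1) \poly_(j < n.+1) f i j)) <= n.+1)%N.
Proof.
apply: (leq_trans (size_sum _ _ _)); apply/bigmax_leqP => i _.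
rewrite coef_poly ltn_ord -!polyC_exp -mulrA -polyCM mulrC.
by rewrite mul_polyC (leq_trans (size_scale_leq _ _)) // size_poly.
Qed.

Lemma map_poly2_poly (A B : nzRingType) (f : {rmorphism A -> B}) (m n : nat)
    (g : nat -> nat -> A) :
  map_poly (map_poly f) (\poly_(i < m) \poly_(j < n) g i j) =
  \poly_(i < m) \poly_(j < n) f (g i j).
Proof.
apply/polyP => i; rewrite coef_map !coef_poly.
case: ifP => _; last by rewrite raddf0.
apply/polyP => j /=; rewrite coef_map !coef_poly.
by case: ifP => _; last by rewrite raddf0.
Qed.

Lemma tofrac_horner (F : fieldType) (q : {poly F}) :
  FracField.tofrac q = (map_poly (@rf_const F) q).[rf_var F].
Proof.
rewrite -{1}(comp_polyXr q) /comp_poly -horner_map -map_poly_comp.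
by congr horner; apply: eq_map_poly.
Qed.

(** * Equality of points of P^1 by cross-multiplication *)

Lemma P1_of_ratio_cross (L : fieldType) (a b c d : L) :
  P1_of_ratio a b = P1_of_ratio c d -> a * d = b * c.
Proof.
rewrite /P1_of_ratio; case: eqP => [->|/eqP b0]; case: eqP => [->|/eqP d0] //.
  by rewrite mulr0 mul0r.
by case=> /eqP; rewrite eqr_div // => /eqP ->; rewrite mulrC.
Qed.

Lemma cross_P1_of_ratio (L : fieldType) (a b c d : L) :
  (a != 0) || (b != 0) -> (c != 0) || (d != 0) ->
  a * d = b * c -> P1_of_ratio a b = P1_of_ratio c d.
Proof.
rewrite /P1_of_ratio; case: (eqVneq b 0) => [->|b0]; case: (eqVneq d 0) => [->|d0];
  rewrite ?orbF ?mul0r ?mulr0 //=.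
- by move=> a0 _ /eqP; rewrite mulf_eq0 (negPf a0) (negPf d0).
- by move=> _ c0 /esym/eqP; rewrite mulf_eq0 (negPf b0) (negPf c0).
- by move=> _ _ e; congr Some; apply/eqP; rewrite eqr_div // e mulrC.
Qed.

(** * Pairs of quadratic polynomials whose quotient has degree exactly 2 *)

Lemma size_lin (A : nzRingType) (v w : A) : (size (v%:P * 'X + w%:P)%R <= 2)%N.
Proof. by rewrite size_MXaddC; case: ifP => // _; rewrite ltnS size_polyC leq_b1. Qed.

Lemma size_quad (A : nzRingType) (u v w : A) :
  (size (u%:P * 'X * 'X + v%:P * 'X + w%:P)%R <= 3)%N.
Proof. by rewrite -mulrDl size_MXaddC; case: ifP => // _; rewrite ltnS size_lin. Qed.

Lemma lin_eq0 (A : nzRingType) (v w : A) : v%:P * 'X + w%:P = 0 -> v = 0 /\ w = 0.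
Proof.
move=> /polyP e; split.
  by have := e 1; rewrite coefD coefMX !coefC /= addr0 => ->.
by have := e 0; rewrite coefD coefMX !coefC /= add0r => ->.
Qed.

(* For P and Q of degree at most 2, a denominator-free way to say that P / Q has
   degree exactly 2: it is not a quotient of polynomials of degree at most 1. *)
Definition irreducible_ratio (A : idomainType) (P Q : {poly A}) : Prop :=
  Q != 0 /\ forall p q : {poly A},
    (size p <= 2)%N -> (size q <= 2)%N -> P * q = Q * p -> q = 0.

Section Pencil.

Variables (A : idomainType) (a m b g n d : A).
Local Notation P := (a%:P * 'X * 'X + m%:P * 'X + b%:P).
Local Notation Q := (g%:P * 'X * 'X + n%:P * 'X + d%:P).
Hypothesis irrPQ : irreducible_ratio P Q.

Lemma irreducible_ratio_eq0 (p q : {poly A}) :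
  (size p <= 2)%N -> (size q <= 2)%N -> P * q = Q * p -> q = 0 /\ p = 0.
Proof.
case: irrPQ => Q0 irr sp sq e; have q0 := irr p q sp sq e; split=> //.
by apply: (mulfI Q0); rewrite -e q0 !mulr0.
Qed.

(** Equality presents [P / Q] by constants, which forces [a = g = 0]; then [P] and [Q] themselves
    have degree at most 1, a contradiction. *)
Lemma irreducible_ratio_lead : P * g%:P != Q * a%:P.
Proof.
apply/eqP => /irreducible_ratio_eq0; rewrite !(leq_trans (size_polyC_leq1 _)) //.
case=> // /eqP; rewrite polyC_eq0 => /eqP g0 /eqP; rewrite polyC_eq0 => /eqP a0.
have [/eqP Q0 irr] := irrPQ; case: Q0; apply: (irr P Q); last exact: mulrC.
  by rewrite a0 !mul0r add0r size_lin.
by rewrite g0 !mul0r add0r size_lin.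
Qed.

(** Otherwise a factor ['X] cancels from [P / Q] and leaves degree at most 1. *)
Lemma irreducible_ratio_const : ~ (b = 0 /\ d = 0).
Proof.
case=> b0 d0; case: irrPQ; rewrite b0 d0 !addr0 -!mulrDl => Q0 irr.
case/eqP: Q0; rewrite (irr (a%:P * 'X + m%:P) (g%:P * 'X + n%:P)) ?size_lin ?mul0r //.
by ring.
Qed.

Lemma irreducible_ratio_lin e :
  P * ((e * g)%:P * 'X - d%:P) != Q * ((e * a)%:P * 'X - b%:P).
Proof.
apply/eqP; rewrite -!polyCN => /irreducible_ratio_eq0; rewrite !size_lin.
case=> // /lin_eq0[_ /eqP d0] /lin_eq0[_ /eqP b0].
apply: irreducible_ratio_const; rewrite !oppr_eq0 in d0 b0.
by rewrite (eqP d0) (eqP b0).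
Qed.

(* Otherwise [P / Q] is also the quotient of [P - (a X^2 - b)] and
   [Q - (g X^2 - d)], which have degree 1. *)
Lemma irreducible_ratio_quad : 2%:R != 0 :> A ->
  P * (g%:P * 'X * 'X - d%:P) != Q * (a%:P * 'X * 'X - b%:P).
Proof.
move=> two0; apply/eqP => e.
have /irreducible_ratio_eq0 : P * (n%:P * 'X + (2%:R * d)%:P) =
    Q * (m%:P * 'X + (2%:R * b)%:P).
  transitivity (P * (Q - (g%:P * 'X * 'X - d%:P))); first by rewrite polyCM; ring.
  by rewrite mulrBr e polyCM; ring.
rewrite !size_lin; case=> // /lin_eq0[_ /eqP d0] /lin_eq0[_ /eqP b0].
apply: irreducible_ratio_const; move: d0 b0.
by rewrite !mulf_eq0 !(negPf two0) => /eqP -> /eqP ->.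
Qed.

(** The resultant lies in the ideal of [P] and [Q], and vanishes only if they share a nonconstant
    factor, whose cancellation would lower the degree of [P / Q]. *)
Lemma irreducible_ratio_bezout : exists2 r : A, r != 0 &
  exists u v, r%:P = u * P + v * Q.
Proof.
case: irrPQ => Q0 irr.
have P0 : P != 0.
  apply/eqP => P0; have := irr 0 1.
  rewrite size_poly0 size_poly1 P0 mul0r mulr0.
  by move=> /(_ isT isT erefl)/eqP; rewrite oner_eq0.
(* [resultant_in_ideal] wants nonconstant polynomials; a constant [P] or [Q] is itself the required
   [r]. *)
case: (leqP (size P) 1) => [/size1_polyC|sP].
  move: (P`_0) => r eP; exists r; first by rewrite -polyC_eq0 -eP.
  by exists 1, 0; rewrite -eP mul1r mul0r addr0.
case: (leqP (size Q) 1) => [/size1_polyC|sQ].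
  move: (Q`_0) => r eQ; exists r; first by rewrite -polyC_eq0 -eQ.
  by exists 0, 1; rewrite -eQ mul1r mul0r add0r.
exists (resultant P Q); last first.
  by have [[u v] _ /= ->] := resultant_in_ideal sP sQ; exists u, v.
rewrite resultant_eq0 -leqNgt leqNgt; apply/negP => sg.
(* The gcd is now nonconstant. Dividing by it, up to the scalars [e] and [f] of pseudo-division,
   leaves [p] and [q] of degree at most 1, to which [irr] applies. *)
have /Pdiv.Idomain.dvdpP[[e p] /= e0 eP] := dvdp_gcdl P Q.
have /Pdiv.Idomain.dvdpP[[f q] /= f0 eQ] := dvdp_gcdr P Q.
set G := gcdp P Q in sg eP eQ.
have G0 : G != 0 by rewrite -size_poly_gt0 (ltn_trans _ sg).
have sz (B r : {poly A}) (l : A) : l != 0 -> (size B <= 3)%N -> l *: B = r * G ->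
    (size r <= 2)%N.
  move=> l0 sB eB; case: (eqVneq r 0) => [->|r0]; first by rewrite size_poly0.
  move: (size_mul r0 G0) sB; rewrite -eB size_scale // => ->.
  case: (size G) sg => [|[|i]] // _; rewrite !addnS /= ltnS.
  exact: leq_trans (leq_addr _ _).
have sp : (size p <= 2)%N := sz _ _ _ e0 (size_quad _ _ _) eP.
have sq : (size q <= 2)%N := sz _ _ _ f0 (size_quad _ _ _) eQ.
have : e *: q = 0.
  apply: (irr (f *: p)); rewrite ?(leq_trans (size_scale_leq _ _)) //.
  apply: (mulIf G0); rewrite -!mulrA -!scalerAl -eP -eQ.
  by rewrite -!mul_polyC; ring.
move/eqP; rewrite -mul_polyC mulf_eq0 polyC_eq0 (negPf e0) /= => /eqP q0.
by move: eQ; rewrite q0 mul0r => /eqP; rewrite -mul_polyC mulf_eq0 polyC_eq0 (negPf f0) (negPf Q0).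
Qed.

End Pencil.

(** Over [k] the polynomial splits into linear factors, and so does its image; a root in [K]
    therefore adds nothing new. *)
Lemma root_map_closed (k : closedFieldType) (K : fieldType) (c : {rmorphism k -> K})
    (r : {poly k}) (b : K) :
  r != 0 -> root (map_poly c r) b -> exists e, b = c e.
Proof.
have [z ->] := closed_field_poly_normal r.
rewrite scaler_eq0 negb_or => /andP[l0 _].
rewrite map_polyZ rmorph_prod /= rootZ ?fmorph_eq0 //.
elim: z => [|y z IHz]; first by rewrite big_nil (negPf (root1 _)).
rewrite big_cons rootM rmorphB /= map_polyX map_polyC root_XsubC.
by case/orP=> [/eqP ->|/IHz //]; exists y.
Qed.

(** * Evaluation of rational functions at points over an abstract field *)

Section GenericPoint.

Variables (k K : fieldType) (c : {rmorphism k -> K}) (t s : K).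

(* [biform] and [rat_value] with k(x, y) replaced by an abstract field K, so
   that conversion never unfolds the field of fractions. *)
Definition biform_over (m n : nat) (M : 'M[k]_(m.+1, n.+1)) (u v : P1 K) : K :=
  \sum_(i < m.+1) \sum_(j < n.+1)
     c (M i j) * (hcoord u).1 ^+ i * (hcoord u).2 ^+ (m - i)
               * (hcoord v).1 ^+ j * (hcoord v).2 ^+ (n - j).

Definition rat_value_over (h u v w : P1 K) : Prop :=
  exists (m n : nat) (P Q : 'M[k]_(m.+1, n.+1)),
    [/\ (P != 0) || (Q != 0),
        h = P1_of_ratio (biform_over P (Some t) (Some s)) (biform_over Q (Some t) (Some s)),
        (biform_over P u v != 0) || (biform_over Q u v != 0)
      & w = P1_of_ratio (biform_over P u v) (biform_over Q u v)].

Definition lift2 : {poly {poly k}} -> {poly {poly K}} := map_poly (map_poly c).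

Definition eval2 (a b : K) (p : {poly {poly k}}) : K := (lift2 p).[a%:P].[b].

Definition polyXY_of_mx m n (M : 'M[k]_(m.+1, n.+1)) : {poly {poly k}} :=
  \poly_(i < m.+1) \poly_(j < n.+1) M (inord i) (inord j).

Lemma biform_hom m n (M : 'M[k]_(m.+1, n.+1)) u v :
  biform_over M u v = hom_eval n (hcoord v).1 (hcoord v).2
    (hom_eval m (hcoord u).1%:P (hcoord u).2%:P (lift2 (polyXY_of_mx M))).
Proof.
rewrite /lift2 /polyXY_of_mx map_poly2_poly hom_eval_poly2; apply: eq_bigr => i _; apply: eq_bigr => j _.
by rewrite !inord_val.
Qed.

Lemma eval2_is_zmod_morphism a b : zmod_morphism (eval2 a b).
Proof. by move=> p q; rewrite /eval2 /lift2 raddfB !hornerE. Qed.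

Lemma eval2_is_monoid_morphism a b : monoid_morphism (eval2 a b).
Proof. by split=> [|p q]; rewrite /eval2 /lift2 ?rmorph1 ?rmorphM !hornerE. Qed.

HB.instance Definition _ a b :=
  GRing.isZmodMorphism.Build {poly {poly k}} K (eval2 a b)
    (@eval2_is_zmod_morphism a b).
HB.instance Definition _ a b :=
  GRing.isMonoidMorphism.Build {poly {poly k}} K (eval2 a b)
    (@eval2_is_monoid_morphism a b).

Lemma eval2X a b : eval2 a b 'X = a.
Proof. by rewrite /eval2 /lift2 map_polyX !hornerE. Qed.

Lemma eval2P q a b : eval2 a b q%:P = (map_poly c q).[b].
Proof. by rewrite /eval2 /lift2 map_polyC !hornerE. Qed.

Lemma eval2Y a b : eval2 a b 'X%:P = b.
Proof. by rewrite eval2P map_polyX hornerX. Qed.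

Lemma eval2C e a b : eval2 a b e%:P%:P = c e.
Proof. by rewrite eval2P map_polyC hornerC. Qed.

Lemma eval2D p q a b : eval2 a b (p + q) = eval2 a b p + eval2 a b q.
Proof. exact: (rmorphD (eval2 a b)). Qed.

Lemma eval2B p q a b : eval2 a b (p - q) = eval2 a b p - eval2 a b q.
Proof. exact: (rmorphB (eval2 a b)). Qed.

Lemma eval2N p a b : eval2 a b (- p) = - eval2 a b p.
Proof. exact: (rmorphN (eval2 a b)). Qed.

Lemma eval2M p q a b : eval2 a b (p * q) = eval2 a b p * eval2 a b q.
Proof. exact: (rmorphM (eval2 a b)). Qed.

Definition eval2E := (eval2D, eval2N, eval2M, eval2X, eval2Y, eval2C).

(** Algebraic independence of [t] and [s] over [k]: the point [(t, s)] is generic. *)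
Hypothesis eval2_generic_inj : forall p, eval2 t s p = 0 -> p = 0.

Lemma size_polyXY_of_mx m n (M : 'M[k]_(m.+1, n.+1)) :
  (size (lift2 (polyXY_of_mx M)) <= m.+1)%N.
Proof. by rewrite (leq_trans (size_poly _ _)) // size_poly. Qed.

Lemma size_hom_polyXY m n (M : 'M[k]_(m.+1, n.+1)) (a b : K) :
  (size (hom_eval m a%:P b%:P (lift2 (polyXY_of_mx M))) <= n.+1)%N.
Proof.
by rewrite /lift2 /polyXY_of_mx map_poly2_poly size_hom_eval_poly2.
Qed.

Lemma biform_finite m n (M : 'M[k]_(m.+1, n.+1)) (a b : K) :
  biform_over M (Some a) (Some b) = eval2 a b (polyXY_of_mx M).
Proof.
rewrite biform_hom /= hom_eval1 ?size_hom_polyXY // polyC1.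
by rewrite hom_eval1 ?size_polyXY_of_mx.
Qed.

Lemma biformM m n m' n' (M : 'M[k]_(m.+1, n.+1)) (N : 'M[k]_(m'.+1, n'.+1)) u v :
  biform_over M u v * biform_over N u v =
  hom_eval (n + n') (hcoord v).1 (hcoord v).2
    (hom_eval (m + m') (hcoord u).1%:P (hcoord u).2%:P
       (lift2 (polyXY_of_mx M * polyXY_of_mx N))).
Proof.
rewrite {1}/lift2 rmorphM hom_evalM ?size_polyXY_of_mx //.
by rewrite hom_evalM ?size_hom_polyXY // !biform_hom.
Qed.

(** An equality at the generic point is an identity of polynomials; homogenised, it holds at every
    point, including those at infinity. Values thus do not depend on the chosen representation. *)
Lemma biform_cross m n m' n' (P Q : 'M[k]_(m.+1, n.+1))
    (P' Q' : 'M[k]_(m'.+1, n'.+1)) :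
  biform_over P (Some t) (Some s) * biform_over Q' (Some t) (Some s) =
    biform_over Q (Some t) (Some s) * biform_over P' (Some t) (Some s) ->
  forall u v, biform_over P u v * biform_over Q' u v = biform_over Q u v * biform_over P' u v.
Proof.
rewrite !biform_finite -!eval2M => /eqP; rewrite -subr_eq0 -eval2B.
by move=> /eqP/eval2_generic_inj/eqP; rewrite subr_eq0 => /eqP eqPQ u v; rewrite !biformM eqPQ.
Qed.

Lemma rat_value_cross (h u v w : P1 K) m n (P Q : 'M[k]_(m.+1, n.+1)) :
  h = P1_of_ratio (biform_over P (Some t) (Some s)) (biform_over Q (Some t) (Some s)) ->
  rat_value_over h u v w ->
  exists a b : K, [/\ (a != 0) || (b != 0), w = P1_of_ratio a b
    & a * biform_over Q u v = b * biform_over P u v].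
Proof.
move=> eh [m' [n' [P' [Q' [_ eh' reg ew]]]]].
exists (biform_over P' u v), (biform_over Q' u v); split=> //.
by apply: biform_cross; apply: P1_of_ratio_cross; rewrite -eh'.
Qed.

Lemma rat_value_uniq (h u v w w' : P1 K) :
  rat_value_over h u v w -> rat_value_over h u v w' -> w = w'.
Proof.
case=> [m [n [P [Q [_ eh reg ->]]]]] hw'.
have [a [b [reg' -> e]]] := rat_value_cross eh hw'.
by apply: cross_P1_of_ratio; rewrite // mulrC -e mulrC.
Qed.

Definition mx_of_polyXY m n (p : {poly {poly k}}) : 'M[k]_(m.+1, n.+1) :=
  \matrix_(i, j) p`_i`_j.

Lemma biform_mx_of_polyXY m n (p : {poly {poly k}}) (a b : K) :
  (size p <= m.+1)%N -> (sizeY p <= n.+1)%N ->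
  biform_over (mx_of_polyXY m n p) (Some a) (Some b) = eval2 a b p.
Proof.
move=> sp spY; rewrite biform_finite; congr eval2; apply/polyP => i.
rewrite coef_poly; case: ltnP => [lt_im|le_mi]; last first.
  by rewrite nth_default ?(leq_trans sp).
apply/polyP => j; rewrite coef_poly; case: ltnP => [lt_jn|le_nj]; last first.
  by rewrite nth_default // (leq_trans (max_size_coefXY _ _)) ?(leq_trans spY).
by rewrite mxE !inordK.
Qed.

(** At affine points with a finite value, quotients of ordinary polynomials may replace
    bihomogeneous forms, which makes closure under field operations easy. *)
Lemma rat_valueP (f a b w : K) :
  rat_value_over (Some f) (Some a) (Some b) (Some w) <->
  exists p q : {poly {poly k}}, [/\ eval2 t s q != 0,
    f = eval2 t s p / eval2 t s q, eval2 a b q != 0 & w = eval2 a b p / eval2 a b q].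
Proof.
split=> [[m [n [P [Q []]]]]|[p [q [q0 ef qab ew]]]].
  rewrite !biform_finite /P1_of_ratio => _; case: eqP => // /eqP Q0 [ef] _.
  by case: eqP => // /eqP Qab [ew]; exists (polyXY_of_mx P), (polyXY_of_mx Q).
(* Sizes exceed degrees by one, which does no harm: any common bound on the two bidegrees will
   do. *)
pose m := maxn (size p) (size q); pose n := maxn (sizeY p) (sizeY q).
have Ep a' b' : biform_over (mx_of_polyXY m n p) (Some a') (Some b') = eval2 a' b' p.
  by rewrite biform_mx_of_polyXY // leqW // leq_maxl.
have Eq a' b' : biform_over (mx_of_polyXY m n q) (Some a') (Some b') = eval2 a' b' q.
  by rewrite biform_mx_of_polyXY // leqW // leq_maxr.
exists m, n, (mx_of_polyXY m n p), (mx_of_polyXY m n q).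
rewrite !Ep !Eq /P1_of_ratio (negPf q0) (negPf qab) ef ew; split=> //; last by rewrite orbT.
apply/orP; right; apply: contra_neq q0 => Q0.
rewrite -Eq Q0 /biform_over big1 // => i _; rewrite big1 // => j _.
by rewrite mxE rmorph0 !mul0r.
Qed.

Lemma rat_value_const (e : k) (a b : K) :
  rat_value_over (Some (c e)) (Some a) (Some b) (Some (c e)).
Proof.
apply/rat_valueP; exists e%:P%:P, 1%:P%:P.
by rewrite !eval2C rmorph1 !divr1 oner_neq0.
Qed.

Lemma rat_value_x (a b : K) : rat_value_over (Some t) (Some a) (Some b) (Some a).
Proof.
apply/rat_valueP; exists 'X, 1%:P%:P.
by rewrite !eval2C !eval2X rmorph1 !divr1 oner_neq0.
Qed.

Lemma rat_value_y (a b : K) : rat_value_over (Some s) (Some a) (Some b) (Some b).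
Proof.
apply/rat_valueP; exists 'X%:P, 1%:P%:P.
by rewrite !eval2C !eval2Y rmorph1 !divr1 oner_neq0.
Qed.

Lemma rat_valueB (f g a b w z : K) :
  rat_value_over (Some f) (Some a) (Some b) (Some w) ->
  rat_value_over (Some g) (Some a) (Some b) (Some z) ->
  rat_value_over (Some (f - g)) (Some a) (Some b) (Some (w - z)).
Proof.
move=> /rat_valueP[p [q [q0 -> qab ->]]] /rat_valueP[p' [q' [q'0 -> q'ab ->]]].
apply/rat_valueP; exists (p * q' - p' * q), (q * q').
by rewrite !eval2B !eval2M !mulf_neq0 //; split=> //; field; apply/andP.
Qed.

Lemma rat_valueM (f g a b w z : K) :
  rat_value_over (Some f) (Some a) (Some b) (Some w) ->
  rat_value_over (Some g) (Some a) (Some b) (Some z) ->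
  rat_value_over (Some (f * g)) (Some a) (Some b) (Some (w * z)).
Proof.
move=> /rat_valueP[p [q [q0 -> qab ->]]] /rat_valueP[p' [q' [q'0 -> q'ab ->]]].
apply/rat_valueP; exists (p * p'), (q * q').
by rewrite !eval2M !mulf_neq0 // !mulf_div.
Qed.

(** As [w] is nonzero, the numerator [p] does not vanish at [(a, b)]; it is then a nonzero
    polynomial, so it does not vanish at the generic point either. *)
Lemma rat_valueV (f a b w : K) : w != 0 ->
  rat_value_over (Some f) (Some a) (Some b) (Some w) ->
  rat_value_over (Some f^-1) (Some a) (Some b) (Some w^-1).
Proof.
move=> w0 /rat_valueP[p [q [q0 -> qab ew]]]; apply/rat_valueP; exists q, p.
have pab : eval2 a b p != 0 by apply: contra_neq w0 => p0; rewrite ew p0 mul0r.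
rewrite ew !invf_div; split=> //; apply: contra_neq pab => p0.
by rewrite (eval2_generic_inj p0) raddf0.
Qed.

(** * The five-term Laurent polynomials and their biquadratic forms *)

Section LaurentFamily.

Variables (c0 c1 c2 e1 e2 : k).

Definition laurent5_over (x y : K) : K :=
  c c0 + c c1 * x + c c2 * y + c e1 / x + c e2 / y.

(* [x * y * laurent5_over x y], as a polynomial and as a biquadratic form *)
Definition laurent_poly : {poly {poly k}} :=
  c0%:P%:P * 'X * 'X%:P + c1%:P%:P * 'X * 'X * 'X%:P
  + c2%:P%:P * 'X * 'X%:P * 'X%:P + e1%:P%:P * 'X%:P + e2%:P%:P * 'X.

Definition laurent_mx : 'M[k]_(3, 3) :=
  \matrix_(i, j) nth 0 (nth [::] [:: [:: 0; e1; 0]; [:: e2; c0; c2]; [:: 0; c1; 0]] i) j.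

Lemma eval2_laurent_poly (a b : K) :
  eval2 a b laurent_poly =
  c c0 * a * b + c c1 * a * a * b + c c2 * a * b * b + c e1 * b + c e2 * a.
Proof. by rewrite /laurent_poly !eval2E. Qed.

Lemma eval2_laurent_polyE (a b : K) : a != 0 -> b != 0 ->
  eval2 a b laurent_poly = a * b * laurent5_over a b.
Proof. by move=> a0 b0; rewrite eval2_laurent_poly /laurent5_over; field; apply/andP. Qed.

Lemma biform_laurent_mx (u v : P1 K) :
  let: (a, a') := hcoord u in let: (b, b') := hcoord v in
  biform_over laurent_mx u v =
  c c0 * a * a' * b * b' + c c1 * a * a * b * b' + c c2 * a * a' * b * b
  + c e1 * a' * a' * b * b' + c e2 * a * a' * b' * b'.
Proof.
case eu: (hcoord u) => [a a'].
case ev: (hcoord v) => [b b'].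
rewrite /biform_over eu ev !big_ord_recl !big_ord0 !mxE /= !rmorph0.
by rewrite /bump /=; ring.
Qed.

Lemma biform_laurent_finite (a b : K) :
  biform_over laurent_mx (Some a) (Some b) = eval2 a b laurent_poly.
Proof.
by rewrite (biform_laurent_mx (Some a) (Some b)) eval2_laurent_poly !mulr1.
Qed.

Lemma biform_laurent_infl (b : K) :
  biform_over laurent_mx None (Some b) = c c1 * b.
Proof. by rewrite (biform_laurent_mx None (Some b)) /=; ring. Qed.

Lemma biform_laurent_infr (a : K) :
  biform_over laurent_mx (Some a) None = c c2 * a.
Proof. by rewrite (biform_laurent_mx (Some a) None) /=; ring. Qed.

End LaurentFamily.

(** * The level curve through the generic point and its two switches *)

Section QRT.

Variables a0 a1 a2 b1 b2 g0 g1 g2 d1 d2 : k.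
Local Notation N := (laurent_poly a0 a1 a2 b1 b2).
Local Notation D := (laurent_poly g0 g1 g2 d1 d2).
Local Notation num := (laurent5_over a0 a1 a2 b1 b2).
Local Notation den := (laurent5_over g0 g1 g2 d1 d2).
Hypothesis den_neq0 : den t s != 0.
Local Notation h := (num t s / den t s).
Local Notation A0 := (c a0 - c g0 * h).
Local Notation A1 := (c a1 - c g1 * h).
Local Notation A2 := (c a2 - c g2 * h).
Local Notation B1 := (c b1 - c d1 * h).
Local Notation B2 := (c b2 - c d2 * h).
Hypothesis A1_neq0 : A1 != 0.
Hypothesis A2_neq0 : A2 != 0.
Hypothesis B1_neq0 : B1 != 0.
Hypothesis B2_neq0 : B2 != 0.
Local Notation x1 := (1 / t * (B1 / A1)).
Local Notation y1 := (1 / s * (B2 / A2)).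
Hypothesis no_base_point : forall a b, b = s \/ b = y1 ->
  eval2 a b N = 0 -> eval2 a b D = 0 -> False.

Lemma t_neq0 : t != 0.
Proof.
apply/eqP => t0; have := @eval2_generic_inj 'X.
by rewrite eval2X => /(_ t0)/eqP; rewrite polyX_eq0.
Qed.

Lemma s_neq0 : s != 0.
Proof.
apply/eqP => s0; have := @eval2_generic_inj 'X%:P.
by rewrite eval2Y => /(_ s0)/eqP; rewrite polyC_eq0 polyX_eq0.
Qed.

Lemma x1_neq0 : x1 != 0.
Proof. by rewrite !mulf_neq0 ?invr_neq0 ?oner_neq0 ?t_neq0. Qed.

Lemma y1_neq0 : y1 != 0.
Proof. by rewrite !mulf_neq0 ?invr_neq0 ?oner_neq0 ?s_neq0. Qed.

Lemma pencil_generic : A0 + A1 * t + A2 * s + B1 / t + B2 / s = 0.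
Proof.
transitivity (num t s - h * den t s); last by rewrite divfK ?subrr.
by rewrite /laurent5_over; ring.
Qed.

(** The substitution of [B1 / (A1 * a)] for [a] exchanges the two summands. *)
Lemma pencil_sum_x a : a = t \/ a = x1 -> A1 * a + B1 / a = A1 * t + B1 / t.
Proof.
case=> -> //; have t0 := t_neq0; move: A1_neq0 B1_neq0.
by set A := A1; set B := B1 => A_0 B_0; field; rewrite t0 A_0 B_0.
Qed.

Lemma pencil_sum_y b : b = s \/ b = y1 -> A2 * b + B2 / b = A2 * s + B2 / s.
Proof.
case=> -> //; have s0 := s_neq0; move: A2_neq0 B2_neq0.
by set A := A2; set B := B2 => A_0 B_0; field; rewrite s0 A_0 B_0.
Qed.

(** The curve equation is a sum of a part in [a] and a part in [b], each unchanged by its switch, so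
    [N = h * D] at [(a, b)]. If [D] vanished there, so would [N], and [(a, b)] would be a base
    point. *)
Lemma rat_value_h a b : a = t \/ a = x1 -> b = s \/ b = y1 ->
  rat_value_over (Some h) (Some a) (Some b) (Some h).
Proof.
move=> ha hb.
have a_0 : a != 0 by case: ha => ->; rewrite ?t_neq0 ?x1_neq0.
have b_0 : b != 0 by case: hb => ->; rewrite ?s_neq0 ?y1_neq0.
have eqND : eval2 a b N = h * eval2 a b D.
  rewrite !eval2_laurent_polyE // mulrCA; congr (_ * _); apply/eqP.
  rewrite -subr_eq0; apply/eqP.
  transitivity (A0 + (A1 * a + B1 / a) + (A2 * b + B2 / b)).
    by move: h => h'; rewrite /laurent5_over; ring.
  by rewrite (pencil_sum_x ha) (pencil_sum_y hb) -[RHS]pencil_generic; ring.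
have Dab : eval2 a b D != 0.
  apply/eqP => Dab; apply: (no_base_point hb (a := a)) => //.
  by rewrite eqND Dab mulr0.
have ts0 : t * s != 0 by rewrite mulf_neq0 ?t_neq0 ?s_neq0.
apply/rat_valueP; exists N, D; rewrite eqND mulfK //; split=> //.
  by rewrite eval2_laurent_polyE ?t_neq0 ?s_neq0 // mulf_neq0.
by rewrite !eval2_laurent_polyE ?t_neq0 ?s_neq0 // -mulf_div divff // mul1r.
Qed.

(** The formula is built by field operations from constants, [t] and [h]; since [h] keeps its value
    at [(a, b)], only the factor [1 / t] changes. *)
Lemma rat_value_x1 a b : a = t \/ a = x1 -> b = s \/ b = y1 ->
  rat_value_over (Some x1) (Some a) (Some b) (Some (1 / a * (B1 / A1))).
Proof.
move=> ha hb; have hv := rat_value_h ha hb.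
have a_0 : a != 0 by case: ha => ->; rewrite ?t_neq0 ?x1_neq0.
have pencil e f : rat_value_over (Some (c e - c f * h)) (Some a) (Some b) (Some (c e - c f * h)).
  by apply: rat_valueB (rat_valueM _ hv); apply: rat_value_const.
apply: rat_valueM (rat_valueM (pencil _ _) (rat_valueV A1_neq0 (pencil _ _))).
rewrite -(rmorph1 c); apply: rat_valueM (rat_value_const _ _ _) _.
exact: rat_valueV a_0 (rat_value_x _ _).
Qed.

Lemma rat_value_y1 a b : a = t \/ a = x1 -> b = s \/ b = y1 ->
  rat_value_over (Some y1) (Some a) (Some b) (Some (1 / b * (B2 / A2))).
Proof.
move=> ha hb; have hv := rat_value_h ha hb.
have b_0 : b != 0 by case: hb => ->; rewrite ?s_neq0 ?y1_neq0.
have pencil e f : rat_value_over (Some (c e - c f * h)) (Some a) (Some b) (Some (c e - c f * h)).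
  by apply: rat_valueB (rat_valueM _ hv); apply: rat_value_const.
apply: rat_valueM (rat_valueM (pencil _ _) (rat_valueV A2_neq0 (pencil _ _))).
rewrite -(rmorph1 c); apply: rat_valueM (rat_value_const _ _ _) _.
exact: rat_valueV b_0 (rat_value_y _ _).
Qed.

Lemma x1_involutive : 1 / x1 * (B1 / A1) = t.
Proof.
move: A1_neq0 B1_neq0 t_neq0; set A := A1; set B := B1 => A_0 B_0 t0.
by field; rewrite t0 A_0 B_0.
Qed.

Lemma y1_involutive : 1 / y1 * (B2 / A2) = s.
Proof.
move: A2_neq0 B2_neq0 s_neq0; set A := A2; set B := B2 => A_0 B_0 s0.
by field; rewrite s0 A_0 B_0.
Qed.

Lemma h_ratio :
  Some h = P1_of_ratio (biform_over (laurent_mx a0 a1 a2 b1 b2) (Some t) (Some s))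
                       (biform_over (laurent_mx g0 g1 g2 d1 d2) (Some t) (Some s)).
Proof.
have ts0 : t * s != 0 by rewrite mulf_neq0 ?t_neq0 ?s_neq0.
rewrite !biform_laurent_finite !eval2_laurent_polyE ?t_neq0 ?s_neq0 //.
by rewrite /P1_of_ratio mulf_eq0 (negPf ts0) (negPf den_neq0) -mulf_div divff // mul1r.
Qed.

(** The value may come from another representation of [h], but by [rat_value_cross] the biquadratic
    one is proportional to it at [(u, v)], so the curve equation holds there, also at infinity. *)
Lemma h_level u v : rat_value_over (Some h) u v (Some h) ->
  biform_over (laurent_mx a0 a1 a2 b1 b2) u v =
  h * biform_over (laurent_mx g0 g1 g2 d1 d2) u v.
Proof.
move=> /(rat_value_cross h_ratio)[a [b [_]]]; rewrite /P1_of_ratio.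
case: eqP => // /eqP b_0 [->] e; apply: (mulfI b_0); rewrite -e.
by rewrite mulrA mulrCA divff // mulr1.
Qed.

Lemma level_x X : rat_value_over (Some h) X (Some s) (Some h) <->
  X = Some t \/ X = Some x1.
Proof.
split=> [/h_level|]; last first.
  by case=> ->; apply: rat_value_h; auto.
have [t0 s0] := (t_neq0, s_neq0).
case: X => [a|]; last first.
  (* At infinity only the coefficient of the square of x survives, so a solution there would give
     [A1 = 0]. *)
  rewrite !biform_laurent_infl => e; case/eqP: A1_neq0.
  by apply: (mulIf s0); rewrite mul0r mulrBl e; ring.
rewrite !biform_laurent_finite !eval2_laurent_poly => /eqP.
rewrite -subr_eq0 => e.
(* Times [s * A1], this product is the curve equation in [a], up to a multiple of [pencil_generic];
   the roots multiply to [B1 / A1]. *)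
have : (a - t) * (a - x1) == 0.
  rewrite -(mulrI_eq0 _ (mulfI (mulf_neq0 s0 A1_neq0))).
  rewrite -[X in _ == X](eqP e); apply/eqP.
  apply/eqP; rewrite -subr_eq0; apply/eqP.
  transitivity (- a * s * (A0 + A1 * t + A2 * s + B1 / t + B2 / s)).
    by move: A1_neq0; set h' := h => A_0; field; rewrite t0 s0 A_0.
  by rewrite pencil_generic mulr0.
by rewrite mulf_eq0 !subr_eq0 => /orP[]/eqP->; auto.
Qed.

Lemma level_y Y : rat_value_over (Some h) (Some t) Y (Some h) <->
  Y = Some s \/ Y = Some y1.
Proof.
split=> [/h_level|]; last first.
  by case=> ->; apply: rat_value_h; auto.
have [t0 s0] := (t_neq0, s_neq0).
case: Y => [b|]; last first.
  rewrite !biform_laurent_infr => e; case/eqP: A2_neq0.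
  by apply: (mulIf t0); rewrite mul0r mulrBl e; ring.
rewrite !biform_laurent_finite !eval2_laurent_poly => /eqP.
rewrite -subr_eq0 => e.
have : (b - s) * (b - y1) == 0.
  rewrite -(mulrI_eq0 _ (mulfI (mulf_neq0 t0 A2_neq0))).
  rewrite -[X in _ == X](eqP e); apply/eqP.
  apply/eqP; rewrite -subr_eq0; apply/eqP.
  transitivity (- b * t * (A0 + A1 * t + A2 * s + B1 / t + B2 / s)).
    by move: A2_neq0; set h' := h => A_0; field; rewrite t0 s0 A_0.
  by rewrite pencil_generic mulr0.
by rewrite mulf_eq0 !subr_eq0 => /orP[]/eqP->; auto.
Qed.

End QRT.

(** * Exchange of the two variables, and nondegeneracy of the pencil *)

Lemma eval2_swapXY (p : {poly {poly k}}) (a b : K) : eval2 a b (swapXY p) = eval2 b a p.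
Proof.
have evalX (q : {poly k}) : eval2 a b (map_poly polyC q) = (map_poly c q).[a].
  elim/poly_ind: q => [|q e IHq]; first by rewrite !raddf0 horner0.
  rewrite !rmorphD !rmorphM /= !map_polyX !map_polyC /=.
  by rewrite IHq !hornerE eval2X eval2C.
elim/poly_ind: p => [|p q IHp]; first by rewrite !raddf0.
rewrite rmorphD rmorphM /= swapXY_X swapXY_polyC !eval2D !eval2M IHp evalX.
by rewrite eval2X eval2P eval2Y.
Qed.

(** Genericity is symmetric, so results for x can be reused for y after exchanging the indices 1 and
    2. *)
Lemma eval2_swap_inj p : eval2 s t p = 0 -> p = 0.
Proof.
rewrite -eval2_swapXY => /eval2_generic_inj/(congr1 (@swapXY _)).
by rewrite swapXYK raddf0.
Qed.

Lemma eval2_injective p q : eval2 t s p = eval2 t s q -> p = q.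
Proof.
by move=> e; apply/eqP; rewrite -subr_eq0; apply/eqP/eval2_generic_inj; rewrite eval2B e subrr.
Qed.

Section Nondegeneracy.

Variables a0 a1 a2 b1 b2 g0 g1 g2 d1 d2 : k.
Local Notation N := (laurent_poly a0 a1 a2 b1 b2).
Local Notation D := (laurent_poly g0 g1 g2 d1 d2).
Local Notation num := (laurent5_over a0 a1 a2 b1 b2).
Local Notation den := (laurent5_over g0 g1 g2 d1 d2).
Hypothesis den_neq0 : den t s != 0.
Hypothesis irrND : irreducible_ratio N D.
Local Notation h := (num t s / den t s).
Local Notation A1 := (c a1 - c g1 * h).
Local Notation B1 := (c b1 - c d1 * h).

(** Collects powers of x over k[y], in the shape required by the results on quadratic pairs. *)
Lemma laurent_polyE c0 c1 c2 e1 e2 : laurent_poly c0 c1 c2 e1 e2 =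
  (c1%:P * 'X)%:P * 'X * 'X + (c0%:P * 'X + c2%:P * 'X * 'X + e2%:P)%:P * 'X
  + (e1%:P * 'X)%:P.
Proof. by rewrite /laurent_poly !polyCD !polyCM; ring. Qed.

Let t0 : t != 0. Proof. exact: t_neq0. Qed.
Let s0 : s != 0. Proof. exact: s_neq0. Qed.

Lemma eval2_ND : eval2 t s N = h * eval2 t s D.
Proof. by rewrite !eval2_laurent_polyE //; field. Qed.

(** Turns a presentation of [h] as [F / G] into the polynomial relation that [irreducible_ratio]
    forbids in low degree. *)
Lemma level_relation (F G : {poly {poly k}}) :
  eval2 t s F = h * eval2 t s G -> N * G = D * F.
Proof.
by move=> e; apply: eval2_injective; rewrite !eval2M e eval2_ND mulrCA mulrA.
Qed.

(** [A1 = 0] reads [c a1 = h * c g1], the case excluded by [irreducible_ratio_lead] once the common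
    factor y is removed. *)
Lemma A1_generic : A1 != 0.
Proof.
have := irrND; rewrite !laurent_polyE => /irreducible_ratio_lead/negP irr.
apply/eqP => A_0; apply: irr; rewrite -!laurent_polyE !polyCM ![_ * 'X%:P]mulrC.
rewrite ![_ * ('X%:P * _)]mulrCA; apply/eqP; congr (_ * _); apply: level_relation.
by rewrite !eval2C mulrC; apply/eqP; rewrite -subr_eq0 A_0.
Qed.

(** Says that the second root [B1 / (A1 * t)] is not the constant [e]; equality would make [h] the
    quotient of [e * a1 * x - b1] by [e * g1 * x - d1]. The case [e = 0] gives [B1 != 0]. *)
Lemma B1_neq_lin e : B1 != c e * t * A1.
Proof.
have := irrND; rewrite !laurent_polyE => /irreducible_ratio_lin/(_ e%:P)/negP irr.
apply/eqP => eB; apply: irr; rewrite -!laurent_polyE.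
have fact u v : (e%:P * (u%:P * 'X))%:P * 'X - (v%:P * 'X)%:P =
    'X%:P * ((e * u)%:P%:P * 'X - v%:P%:P) :> {poly {poly k}}.
  by rewrite !polyCM; ring.
rewrite !fact ![_ * ('X%:P * _)]mulrCA; apply/eqP; congr (_ * _).
apply: level_relation; rewrite !eval2E !rmorphM.
apply/eqP; rewrite -subr_eq0; apply/eqP.
by transitivity (c e * t * A1 - B1); [ring | rewrite eB subrr].
Qed.

(** Says that the second root differs from [t], so that the level equation has no double root. *)
Lemma B1_neq_quad : 2%:R != 0 :> k -> B1 != t * t * A1.
Proof.
move=> two0; have := irrND; rewrite !laurent_polyE => /irreducible_ratio_quad.
have two0' : 2%:R != 0 :> {poly k} by rewrite -polyC_natr polyC_eq0.
move=> /(_ two0')/negP irr; apply/eqP => eB; apply: irr; rewrite -!laurent_polyE.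
have fact u v : (u%:P * 'X)%:P * 'X * 'X - (v%:P * 'X)%:P =
    'X%:P * (u%:P%:P * 'X * 'X - v%:P%:P) :> {poly {poly k}}.
  by rewrite !polyCM; ring.
rewrite !fact ![_ * ('X%:P * _)]mulrCA; apply/eqP; congr (_ * _).
apply: level_relation; rewrite !eval2E.
apply/eqP; rewrite -subr_eq0; apply/eqP.
by transitivity (t * t * A1 - B1); [ring | rewrite eB subrr].
Qed.

(** The element [r = u * N + v * D] of k[y] vanishes at every common zero. *)
Lemma common_zero_algebraic a b : eval2 a b N = 0 -> eval2 a b D = 0 ->
  exists2 r : {poly k}, r != 0 & root (map_poly c r) b.
Proof.
have := irrND; rewrite !laurent_polyE => /irreducible_ratio_bezout[r r0 [u [v e]]].
rewrite -!laurent_polyE in e * => Nab Dab; exists r => //.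
by rewrite /root -(eval2P _ a) e eval2D !eval2M Nab Dab !mulr0 addr0.
Qed.

End Nondegeneracy.

Section LaurentRatio.

Variables a0 a1 a2 b1 b2 g0 g1 g2 d1 d2 : k.

Lemma laurent_poly_neq0 :
  laurent5_over g0 g1 g2 d1 d2 t s != 0 -> laurent_poly g0 g1 g2 d1 d2 != 0.
Proof.
apply: contra_neq => D0.
have [t0 s0] := (t_neq0, s_neq0).
apply: (mulfI (mulf_neq0 t0 s0)).
by rewrite mulr0 -eval2_laurent_polyE // D0 raddf0.
Qed.

Lemma laurent_poly_swap_neq0 :
  laurent_poly g0 g1 g2 d1 d2 != 0 -> laurent_poly g0 g2 g1 d2 d1 != 0.
Proof.
apply: contra_neq => D0; apply: eval2_swap_inj.
transitivity (eval2 t s (laurent_poly g0 g2 g1 d2 d1)); last by rewrite D0 raddf0.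
by rewrite !eval2_laurent_poly; ring.
Qed.

Lemma laurent_ratio (a b : K) : a != 0 -> b != 0 ->
  laurent5_over a0 a1 a2 b1 b2 a b / laurent5_over g0 g1 g2 d1 d2 a b =
  eval2 a b (laurent_poly a0 a1 a2 b1 b2) / eval2 a b (laurent_poly g0 g1 g2 d1 d2).
Proof.
move=> a_0 b_0; rewrite !eval2_laurent_polyE // -mulf_div divff ?mul1r //.
exact: mulf_neq0.
Qed.

Lemma laurent_ratio_swap (a b : K) : a != 0 -> b != 0 ->
  laurent5_over a0 a1 a2 b1 b2 b a / laurent5_over g0 g1 g2 d1 d2 b a =
  eval2 a b (laurent_poly a0 a2 a1 b2 b1) / eval2 a b (laurent_poly g0 g2 g1 d2 d1).
Proof.
move=> a_0 b_0; rewrite laurent_ratio // !eval2_laurent_poly.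
by congr (_ / _); ring.
Qed.

End LaurentRatio.

End GenericPoint.
Lemma laurent5_over_swap (k K : fieldType) (c : {rmorphism k -> K})
    (c0 c1 c2 e1 e2 : k) (x y : K) :
  laurent5_over c c0 c2 c1 e2 e1 y x = laurent5_over c c0 c1 c2 e1 e2 x y.
Proof. by rewrite /laurent5_over; ring. Qed.

(** * Absence of base points, and values of the map at the switched points *)

Section ClosedField.

Variables (k : numClosedFieldType) (K : fieldType) (c : {rmorphism k -> K}) (t s : K).
Hypothesis inj_ts : forall p, eval2 c t s p = 0 -> p = 0.
Variables a0 a1 a2 b1 b2 g0 g1 g2 d1 d2 : k.
Local Notation num := (laurent5_over c a0 a1 a2 b1 b2).
Local Notation den := (laurent5_over c g0 g1 g2 d1 d2).
Hypothesis den_neq0 : den t s != 0.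
Hypothesis irr_x :
  irreducible_ratio (laurent_poly a0 a1 a2 b1 b2) (laurent_poly g0 g1 g2 d1 d2).
Hypothesis irr_y :
  irreducible_ratio (laurent_poly a0 a2 a1 b2 b1) (laurent_poly g0 g2 g1 d2 d1).
Local Notation h := (num t s / den t s).
Local Notation A1 := (c a1 - c g1 * h).
Local Notation A2 := (c a2 - c g2 * h).
Local Notation B1 := (c b1 - c d1 * h).
Local Notation B2 := (c b2 - c d2 * h).
Local Notation x1 := (1 / t * (B1 / A1)).
Local Notation y1 := (1 / s * (B2 / A2)).
Local Notation rat_value := (rat_value_over c t s).

Let two0 : 2%:R != 0 :> k. Proof. by rewrite Num.Theory.pnatr_eq0. Qed.
Let inj_st := eval2_swap_inj inj_ts.
Let t0 : t != 0 := t_neq0 inj_ts.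
Let s0 : s != 0 := s_neq0 inj_ts.

Let den_st : laurent5_over c g0 g2 g1 d2 d1 s t != 0.
Proof. by rewrite laurent5_over_swap. Qed.

Let A1_0 : A1 != 0. Proof. exact: A1_generic. Qed.
Let B1_0 : B1 != 0.
Proof. by have := B1_neq_lin inj_ts den_neq0 irr_x 0; rewrite rmorph0 !mul0r. Qed.
(** The statement for [A1] at the point [(s, t)], with the indices 1 and 2 exchanged; likewise for
    [B2] below. *)
Let A2_0 : A2 != 0.
Proof. by have := A1_generic inj_st den_st irr_y; rewrite !(laurent5_over_swap c _ _ _ _ _ t s). Qed.
Let B2_neq_lin e : B2 != c e * s * A2.
Proof. by have := B1_neq_lin inj_st den_st irr_y e; rewrite !(laurent5_over_swap c _ _ _ _ _ t s). Qed.
Let B2_0 : B2 != 0.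
Proof. by have := B2_neq_lin 0; rewrite rmorph0 !mul0r. Qed.

Lemma x1_neq : x1 != t.
Proof.
apply: contra_neq (B1_neq_quad inj_ts den_neq0 irr_x two0) => ex; transitivity (t * x1 * A1); last by rewrite ex.
by move: A1_0; set h' := h => A_0; field; rewrite t0 A_0.
Qed.

Lemma y1_neq : y1 != s.
Proof.
have := B1_neq_quad inj_st den_st irr_y two0; rewrite !(laurent5_over_swap c _ _ _ _ _ t s).
apply: contra_neq => ey; transitivity (s * y1 * A2); last by rewrite ey.
by move: A2_0; set h' := h => A_0; field; rewrite s0 A_0.
Qed.

(* The base points of the pencil have algebraic coordinates. *)
Let no_base_point a b : b = s \/ b = y1 ->
  eval2 c a b (laurent_poly a0 a1 a2 b1 b2) = 0 ->
  eval2 c a b (laurent_poly g0 g1 g2 d1 d2) = 0 -> False.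
Proof.
move=> hb Nab Dab.
have [r r0 /(root_map_closed r0)[e eb]] := common_zero_algebraic irr_x Nab Dab.
case: hb => hb.
  have := inj_ts (p := 'X%:P - e%:P%:P); rewrite eval2B eval2Y eval2C -eb hb subrr.
  by move=> /(_ erefl)/eqP; rewrite -polyCB polyC_eq0 polyXsubC_eq0.
(* [y1 = c e] amounts to [B2 = c e * s * A2]. *)
case/eqP: (B2_neq_lin e); rewrite -eb hb.
by move: A2_0; set h' := h => A_0; field; rewrite s0 A_0.
Qed.

Lemma sigma1_level X : rat_value (Some h) X (Some s) (Some h) <->
  X = Some t \/ X = Some x1.
Proof. exact: level_x. Qed.

Lemma sigma2_level Y : rat_value (Some h) (Some t) Y (Some h) <->
  Y = Some s \/ Y = Some y1.
Proof. exact: level_y. Qed.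

Let phi_values a b : a = t \/ a = x1 -> b = s \/ b = y1 ->
  rat_value (Some x1) (Some a) (Some b) (Some (1 / a * (B1 / A1))) /\
  rat_value (Some y1) (Some a) (Some b) (Some (1 / b * (B2 / A2))).
Proof. by move=> ha hb; split; [apply: rat_value_x1 | apply: rat_value_y1]. Qed.

(** Both coordinates switch back: this gives involutivity and the relation for the inverse. *)
Lemma phi_at_X_Y : rat_value (Some x1) (Some x1) (Some y1) (Some t) /\
  rat_value (Some y1) (Some x1) (Some y1) (Some s).
Proof.
have := phi_values (or_intror (erefl x1)) (or_intror (erefl y1)).
by rewrite (x1_involutive inj_ts A1_0 B1_0) (y1_involutive inj_ts A2_0 B2_0).
Qed.

(** The relation for the companion map; its second half also computes the composition of the two
    switches. *)
Lemma phi_at_X_y : rat_value (Some x1) (Some x1) (Some s) (Some t) /\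
  rat_value (Some y1) (Some x1) (Some s) (Some y1).
Proof.
have := phi_values (or_intror (erefl x1)) (or_introl (erefl s)).
by rewrite (x1_involutive inj_ts A1_0 B1_0).
Qed.

(** The relation for the inverse of the companion map. *)
Lemma phi_at_x_Y : rat_value (Some x1) (Some t) (Some y1) (Some x1) /\
  rat_value (Some y1) (Some t) (Some y1) (Some s).
Proof.
have := phi_values (or_introl (erefl t)) (or_intror (erefl y1)).
by rewrite (y1_involutive inj_ts A2_0 B2_0).
Qed.

Lemma h_biquadratic : exists P Q : 'M[k]_(3, 3), ((P != 0) || (Q != 0)) /\
  Some h = P1_of_ratio (biform_over c P (Some t) (Some s))
                       (biform_over c Q (Some t) (Some s)).
Proof.
exists (laurent_mx a0 a1 a2 b1 b2), (laurent_mx g0 g1 g2 d1 d2).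
split; last exact: h_ratio.
apply/orP; right; apply: contra_neq den_neq0 => Q0.
apply: (mulfI (mulf_neq0 t0 s0)); rewrite mulr0 -eval2_laurent_polyE //.
rewrite -biform_laurent_finite Q0 /biform_over big1 // => i _; rewrite big1 // => j _.
by rewrite mxE rmorph0 !mul0r.
Qed.

End ClosedField.

(** * The field k(y)(x): degrees of rational functions and genericity of (x, y) *)

Lemma tofrac_inj (D : idomainType) : injective (@FracField.tofrac D).
Proof. by move=> a b /eqP; rewrite tofrac_eq => /eqP. Qed.

(** By Gauss, the coprime numerator and denominator divide those of any other presentation. *)
Lemma has_degree_leq (F : fieldType) (h : ratfun F) (d : nat) (p q : {poly F}) :
  has_degree h d -> q != 0 -> h = FracField.tofrac p / FracField.tofrac q ->
  (d < maxn (size p) (size q))%N.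
Proof.
case=> p0 [q0 [q0_neq0 cop -> sz]] q_neq0 /eqP.
rewrite eqr_div ?tofrac_eq0 // -!tofracM tofrac_eq => /eqP e.
rewrite -sz geq_max !leq_max; apply/andP; split.
  have [p_0|p_neq0] := eqVneq p 0; last first.
    by rewrite dvdp_leq // -(Gauss_dvdpl _ cop) -e dvdp_mulr.
  move/eqP: e; rewrite p_0 mul0r mulf_eq0 (negPf q_neq0) orbF => /eqP ->.
  by rewrite size_poly0.
by rewrite orbC dvdp_leq // -(@Gauss_dvdpr _ q p0) 1?coprimep_sym // e dvdp_mull.
Qed.

(** Evaluation at (x, y) is the embedding of k[y][x] into its fraction field k(y)(x), hence
    injective. *)
Lemma eval2_generic (k : fieldType) (p : {poly {poly k}}) :
  eval2 (@rf2_const k) (outer_var k) (inner_var k) p =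
  FracField.tofrac (map_poly (@FracField.tofrac {poly k}) p).
Proof.
elim/poly_ind: p => [|p q IHp]; first by rewrite !raddf0.
rewrite eval2D eval2M eval2X IHp eval2P !rmorphD !rmorphM /= map_polyX map_polyC /=.
congr (_ + _); rewrite -[RHS]/(rf_const (FracField.tofrac q)) tofrac_horner.
by rewrite -horner_map -map_poly_comp.
Qed.

Lemma eval2_generic_inj (k : fieldType) (p : {poly {poly k}}) :
  eval2 (@rf2_const k) (outer_var k) (inner_var k) p = 0 -> p = 0.
Proof.
rewrite eval2_generic => /eqP; rewrite tofrac_eq0.
move=> /eqP p0; apply: (map_inj_poly (@tofrac_inj _) (tofrac0 _)).
by rewrite p0 raddf0.
Qed.

Lemma eval2_ratio (k K : fieldType) (c : {rmorphism k -> K}) (t s : K)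
    (N D p q : {poly {poly k}}) :
  eval2 c t s D != 0 -> eval2 c t s q != 0 -> N * q = D * p ->
  eval2 c t s N / eval2 c t s D = eval2 c t s p / eval2 c t s q.
Proof.
by move=> D0 q0 e; apply/eqP; rewrite eqr_div // -!eval2M e mulrC.
Qed.

(** A relation [N * q = D * p] with [q != 0] and [p], [q] of degree at most 1 would give
    [h = p / q], against [has_degree_leq]. *)
Lemma irreducible_ratio_degree (k : fieldType) (N D : {poly {poly k}}) (h : ratfun2 k) :
  has_degree h 2 -> D != 0 ->
  h = eval2 (@rf2_const k) (outer_var k) (inner_var k) N /
      eval2 (@rf2_const k) (outer_var k) (inner_var k) D ->
  irreducible_ratio N D.
Proof.
move=> deg D0 eh; split=> // p q sp sq e; apply/eqP/negPn/negP => q0.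
have ev0 r : r != 0 -> eval2 (@rf2_const k) (outer_var k) (inner_var k) r != 0.
  by apply: contra_neq; apply: eval2_generic_inj.
have := etrans eh (eval2_ratio (ev0 _ D0) (ev0 _ q0) e).
rewrite !eval2_generic => /(has_degree_leq deg).
have inj0 : injective (map_poly (@FracField.tofrac {poly k})).
  exact: map_inj_poly (@tofrac_inj _) (tofrac0 _).
rewrite -(inj_eq inj0) raddf0 in q0 => /(_ q0).
by rewrite !size_map_inj_poly ?tofrac0 //; try exact: tofrac_inj; rewrite ltnNge geq_max sp sq.
Qed.

(** * The QRT map and quadrirationality from the computed values *)

Section Assembly.

Variables (k : fieldType) (h x1 y1 : ratfun2 k).
Local Notation x := (outer_var k).
Local Notation y := (inner_var k).
Local Notation phi := ((Some x1, Some y1) : ratmap k).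
Hypothesis h_biq : biquadratic_ratio (Some h).
Hypotheses (x1_neq_x : x1 != x) (y1_neq_y : y1 != y).
Hypothesis level1 : forall X, rat_value (Some h) X (Some y) (Some h) <->
  X = Some x \/ X = Some x1.
Hypothesis level2 : forall Y, rat_value (Some h) (Some x) Y (Some h) <->
  Y = Some y \/ Y = Some y1.
Hypothesis at_XY : rat_value (Some x1) (Some x1) (Some y1) (Some x) /\
  rat_value (Some y1) (Some x1) (Some y1) (Some y).
Hypothesis at_Xy : rat_value (Some x1) (Some x1) (Some y) (Some x) /\
  rat_value (Some y1) (Some x1) (Some y) (Some y1).
Hypothesis at_xY : rat_value (Some x1) (Some x) (Some y1) (Some x1) /\
  rat_value (Some y1) (Some x) (Some y1) (Some y).

Let x_at_Xy : rat_value (Some x) (Some x1) (Some y) (Some x1).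
Proof. exact: (rat_value_x (@rf2_const k)). Qed.

(** [x1] solves the level equation and differs from x, so it must be the second solution. *)
Lemma is_sigma1E s1 : is_sigma1 (Some h) s1 <-> s1 = (Some x1, P1y k).
Proof.
split=> [|->]; last by split=> //; case=> /eqP; rewrite (negPf x1_neq_x).
case: s1 => u v [/= u_neq lev ->]; congr pair.
have /lev[] // : rat_value (Some h) (Some x1) (P1y k) (Some h) by apply/level1; right.
by case=> /eqP; rewrite (negPf x1_neq_x).
Qed.

Lemma is_sigma2E s2 : is_sigma2 (Some h) s2 <-> s2 = (P1x k, Some y1).
Proof.
split=> [|->]; last by split=> //; case=> /eqP; rewrite (negPf y1_neq_y).
case: s2 => u v [/= v_neq lev ->]; congr pair.
have /lev[] // : rat_value (Some h) (P1x k) (Some y1) (Some h) by apply/level2; right.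
by case=> /eqP; rewrite (negPf y1_neq_y).
Qed.

(** The composition evaluates [(x, y1)] at [(x1, y)], where [y1] keeps its value; uniqueness of
    values then determines [f]. *)
Lemma is_qrt_mapE f : is_qrt_map (Some h) f <-> f = phi.
Proof.
split=> [[_ [s1 [s2 []]]]|->].
  move=> /is_sigma1E-> /is_sigma2E-> [/= fx fy]; case: f fx fy => u v /= fx fy.
  congr pair.
    exact: rat_value_uniq (@eval2_generic_inj k) _ _ _ _ _ fx x_at_Xy.
  exact: rat_value_uniq (@eval2_generic_inj k) _ _ _ _ _ fy at_Xy.2.
split=> //; exists (Some x1, P1y k), (P1x k, Some y1).
by split; [apply/is_sigma1E | apply/is_sigma2E | split; [| exact: at_Xy.2]].
Qed.

Lemma phi_quadrirational : quadrirational_narrow phi.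
Proof.
exists phi, phi, phi; split; last by split; reflexivity.
(* With [S = R], the two halves of each relation are the same statement. *)
by split; split; [exact at_XY | exact at_XY | exact at_Xy | exact at_Xy | exact at_xY | exact at_xY].
Qed.

End Assembly.

Theorem proposition2p2 (R : realType)
    (alpha0 alpha1 alpha2 beta1 beta2 gamma0 gamma1 gamma2 delta1 delta2 : R[i]) :
  let K : fieldType := ratfun2 R[i] in
  let num (x y : K) : K := laurent5 alpha0 alpha1 alpha2 beta1 beta2 x y in
  let den (x y : K) : K := laurent5 gamma0 gamma1 gamma2 delta1 delta2 x y in
  let H (x y : K) : K := num x y / den x y in
  let s : K := inner_var R[i] in
  let t : K := outer_var R[i] in
  (* H is well defined *)
  den t s != 0 ->
  (* degree in x over C(y), then degree in y over C(x) *)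
  has_degree (H t s) 2 ->
  has_degree (H s t) 2 ->
  let x : K := t in
  let y : K := s in
  let h : K := H x y in
  let c (a : R[i]) : K := rf2_const a in
  let phi : ratmap R[i] :=
    (Some (1 / x * ((c beta1 - c delta1 * h) / (c alpha1 - c gamma1 * h))),
     Some (1 / y * ((c beta2 - c delta2 * h) / (c alpha2 - c gamma2 * h)))) in
  [/\ forall f : ratmap R[i], is_qrt_map (Some h) f <-> f = phi,
      is_comp phi phi (rm_id R[i])
    & quadrirational_narrow phi].
Proof.
move=> K num den H s t den0 deg1 deg2 x y h c phi.
have inj := @eval2_generic_inj R[i].
have [t0 s0] := (t_neq0 inj, s_neq0 inj).
have D0 := laurent_poly_neq0 inj den0.
have irr1 := irreducible_ratio_degree deg1 D0
  (laurent_ratio _ alpha0 alpha1 alpha2 beta1 beta2 gamma0 gamma1 gamma2 delta1 delta2 t0 s0).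
(* In [H s t] the outer variable stands for y, so the polynomials have the indices 1 and 2
   exchanged. *)
have irr2 := irreducible_ratio_degree deg2 (laurent_poly_swap_neq0 inj D0)
  (laurent_ratio_swap _ alpha0 alpha1 alpha2 beta1 beta2 gamma0 gamma1 gamma2 delta1 delta2 t0 s0).
have lev1 := sigma1_level inj den0 irr1 irr2.
have lev2 := sigma2_level inj den0 irr1 irr2.
have at1 := phi_at_X_Y inj den0 irr1 irr2.
have at2 := phi_at_X_y inj den0 irr1 irr2.
have at3 := phi_at_x_Y inj den0 irr1 irr2.
have biq := h_biquadratic inj alpha0 alpha1 alpha2 beta1 beta2 den0.
have nx := x1_neq inj den0 irr1.
have ny := y1_neq inj den0 irr2.
split.
- exact: is_qrt_mapE biq nx ny lev1 lev2 at2.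
- exact: at1.
- exact: phi_quadrirational at1 at2 at3.
Qed.
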